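(* Let $G_1=(V_1,E_1)$ and $G_2=(V_2,E_2)$ be graphs. Then $\mathrm{thin}(G_1\circ G_2)\leq \mathrm{indthin}(G_1\circ G_2)\leq |V_1|\,\mathrm{indthin}(G_2)$ and $\mathrm{pthin}(G_1\circ G_2)\leq \mathrm{indpthin}(G_1\circ G_2)\leq |V_1|\,\mathrm{indpthin}(G_2)$.
   Context: Graphs are finite, simple, undirected (loopless). The hom-product $G_1\circ G_2$ has vertex set $V_1\times V_2$, and $(u_1,u_2)$, $(v_1,v_2)$ are adjacent iff $u_1\neq v_1$ and either $u_1v_1\notin E_1$ or $u_2v_2\in E_2$. For a graph $G=(V,E)$, an ordering $v_1,\dots,v_n$ of $V$ and a partition of $V$ are consistent if for every $r<s<t$, whenever $v_r,v_s$ are in the same class and $v_tv_r\in E$, then $v_tv_s\in E$; strongly consistent if moreover for every $r<s<t$, whenever $v_s,v_t$ are in the same class and $v_tv_r\in E$, then $v_sv_r\in E$. $\mathrm{thin}(G)$ (resp. $\mathrm{pthin}(G)$) is the minimum number of classes of a partition of $V$ consistent (resp. strongly consistent) with some ordering of $V$; $\mathrm{indthin}$ (resp. $\mathrm{indpthin}$) is the same minimum when each class is additionally required to be an independent set. *)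

(* Defs.v *)
From HB Require Import structures.
From mathcomp Require Import all_boot.

Set Implicit Arguments.
Unset Strict Implicit.
Unset Printing Implicit Defensive.

Record sgraph := SGraph {
  vertex :> finType;
  adj : rel vertex;
  adj_sym : symmetric adj;
  adj_irrefl : irreflexive adj }.

Section HomProduct.
Variables G1 G2 : sgraph.

Definition hom_adj : rel (G1 * G2) :=
  fun u v => (u.1 != v.1) && (~~ adj u.1 v.1 || adj u.2 v.2).

Lemma hom_adj_sym : symmetric hom_adj.
Proof.
by move=> u v; rewrite /hom_adj eq_sym (adj_sym u.1) (adj_sym u.2).
Qed.

Lemma hom_adj_irrefl : irreflexive hom_adj.
Proof. by move=> u; rewrite /hom_adj eqxx. Qed.

Definition hom_product : sgraph := SGraph hom_adj_sym hom_adj_irrefl.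

End HomProduct.

Section Thinness.
Variable G : sgraph.

(* A duplicate-free tuple of length #|G| lists every vertex exactly once. *)
Definition is_ordering (v : #|G|.-tuple G) : bool := uniq v.

Definition same_class (P : {set {set G}}) (x y : G) : bool :=
  pblock P x == pblock P y.

Definition consistent (v : #|G|.-tuple G) (P : {set {set G}}) : bool :=
  [forall r : 'I_#|G|, forall s : 'I_#|G|, forall t : 'I_#|G|,
    [&& r < s, s < t, same_class P (tnth v r) (tnth v s)
      & adj (tnth v t) (tnth v r)] ==> adj (tnth v t) (tnth v s)].

Definition strongly_consistent (v : #|G|.-tuple G) (P : {set {set G}}) : bool :=
  consistent v P &&
  [forall r : 'I_#|G|, forall s : 'I_#|G|, forall t : 'I_#|G|,
    [&& r < s, s < t, same_class P (tnth v s) (tnth v t)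
      & adj (tnth v t) (tnth v r)] ==> adj (tnth v s) (tnth v r)].

Definition independent (A : {set G}) : bool :=
  [forall x in A, forall y in A, ~~ adj x y].

Definition thin_with (k : nat) : bool :=
  [exists P : {set {set G}}, [&& partition P [set: G], #|P| == k
    & [exists v, is_ordering v && consistent v P]]].

Definition pthin_with (k : nat) : bool :=
  [exists P : {set {set G}}, [&& partition P [set: G], #|P| == k
    & [exists v, is_ordering v && strongly_consistent v P]]].

Definition indthin_with (k : nat) : bool :=
  [exists P : {set {set G}}, [&& partition P [set: G], #|P| == k,
      [forall A in P, independent A]
    & [exists v, is_ordering v && consistent v P]]].

Definition indpthin_with (k : nat) : bool :=
  [exists P : {set {set G}}, [&& partition P [set: G], #|P| == k,
      [forall A in P, independent A]
    & [exists v, is_ordering v && strongly_consistent v P]]].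

(* The partition into singletons is strongly consistent with any ordering. *)
Lemma indpthin_with_ex : exists k, indpthin_with k.
Proof.
pose P := preim_partition (@id G) [set: G].
have partP : partition P [set: G] by apply: preim_partitionP.
have eq_class x y : same_class P x y -> x = y.
  rewrite /same_class eq_pblock ?(partition_trivIset partP) //; last first.
    by rewrite (cover_partition partP) inE.
  rewrite /P /preim_partition pblock_equivalence_partition ?inE //.
    by move/eqP.
  by split=> // /eqP->.
exists #|P|; apply/existsP; exists P; apply/and4P; split=> //.
  apply/forall_inP=> A AP; apply/forall_inP=> x xA; apply/forall_inP=> y yA.
  have tP := partition_trivIset partP.
  have -> : x = y.
    by apply: eq_class; rewrite /same_class !(def_pblock tP AP).
  by rewrite adj_irrefl.
apply/existsP; exists (enum_tuple G).
rewrite /is_ordering enum_uniq /=; apply/andP; split.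
  apply/forallP=> r; apply/forallP=> s; apply/forallP=> t.
  by apply/implyP=> /and4P[_ _ /eq_class ->].
apply/forallP=> r; apply/forallP=> s; apply/forallP=> t.
by apply/implyP=> /and4P[_ _ /eq_class ->].
Qed.

Lemma indpthin_indthin k : indpthin_with k -> indthin_with k.
Proof.
case/existsP=> P /and4P[H1 H2 H3 /existsP[v /and3P[H4 H5 _]]].
apply/existsP; exists P; apply/and4P; split=> //.
by apply/existsP; exists v; rewrite H4.
Qed.

Lemma indpthin_pthin k : indpthin_with k -> pthin_with k.
Proof.
case/existsP=> P /and4P[H1 H2 _ H4].
by apply/existsP; exists P; apply/and3P.
Qed.

Lemma indthin_thin k : indthin_with k -> thin_with k.
Proof.
case/existsP=> P /and4P[H1 H2 _ H4].
by apply/existsP; exists P; apply/and3P.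
Qed.

Lemma indthin_with_ex : exists k, indthin_with k.
Proof. by have [k /indpthin_indthin] := indpthin_with_ex; exists k. Qed.

Lemma pthin_with_ex : exists k, pthin_with k.
Proof. by have [k /indpthin_pthin] := indpthin_with_ex; exists k. Qed.

Lemma thin_with_ex : exists k, thin_with k.
Proof. by have [k /indthin_thin] := indthin_with_ex; exists k. Qed.

Definition thin : nat := ex_minn thin_with_ex.
Definition pthin : nat := ex_minn pthin_with_ex.
Definition indthin : nat := ex_minn indthin_with_ex.
Definition indpthin : nat := ex_minn indpthin_with_ex.

End Thinness.

(* Main.v *)
Require Import Defs.
From mathcomp Require Import all_boot.

(** Let [P] be a partition of [G2] into independent sets, consistent with an
    ordering [v]. Partition [G1 * G2] into the sets [{u} x A], [A \in P], and
    order it by the [v]-position of the second coordinate, breaking ties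
    arbitrarily. The classes are independent, since adjacent vertices of the
    hom-product differ in their first coordinate. Two distinct vertices of one
    class have distinct second coordinates, so the only triples to which
    consistency of [v] does not apply are those where the third vertex shares
    its second coordinate with a vertex of the class; there, the adjacency
    required in [G2] would lie within a class of [P], contradicting its
    independence. *)

Set Implicit Arguments.
Unset Strict Implicit.
Unset Printing Implicit Defensive.

Section Orderings.
Variable G : sgraph.
Implicit Types (v : #|G|.-tuple G) (P : {set {set G}}).

(** A duplicate-free tuple of length [#|G|] has full cardinality as a subset of [G]. *)
Lemma mem_ordering v x : is_ordering v -> x \in v.
Proof.
move=> uv; have cv : #|v| = #|G| by rewrite (card_uniqP uv) size_tuple.
by rewrite (subset_cardP cv (subset_predT _) x) inE.
Qed.

Lemma index_ordering_lt v x : is_ordering v -> index x v < #|G|.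
Proof. by move=> /mem_ordering xv; rewrite -[X in _ < X](size_tuple v) index_mem. Qed.

Lemma tnth_index_ordering v x (uv : is_ordering v) :
  tnth v (Ordinal (index_ordering_lt x uv)) = x.
Proof. by rewrite (tnth_nth x) nth_index ?mem_ordering. Qed.

Lemma index_tnth_ordering v i : is_ordering v -> index (tnth v i) v = i.
Proof. by move=> uv; rewrite (tnth_nth (tnth v i)) index_uniq ?size_tuple. Qed.

(** Quantifying over vertices instead of positions allows triples in the product to be compared with
    their projections, which sit in a different ordering. *)
Lemma consistentP v P : is_ordering v ->
  reflect (forall x y z, index x v < index y v -> index y v < index z v ->
             same_class P x y -> adj z x -> adj z y)
          (consistent v P).
Proof.
move=> uv; apply: (iffP idP) => [cv x y z xy yz Pxy zx | cv].
  move/'forall_'forall_forallP: cv => /(_ (Ordinal (index_ordering_lt x uv))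
    (Ordinal (index_ordering_lt y uv)) (Ordinal (index_ordering_lt z uv))).
  by rewrite !tnth_index_ordering /= xy yz Pxy zx.
apply/'forall_'forall_forallP=> r s t; apply/implyP=> /and4P[rs st].
by apply: cv; rewrite !index_tnth_ordering.
Qed.

Lemma strongly_consistentP v P : is_ordering v ->
  reflect (consistent v P /\
           forall x y z, index x v < index y v -> index y v < index z v ->
             same_class P y z -> adj z x -> adj y x)
          (strongly_consistent v P).
Proof.
move=> uv; apply: (iffP andP) => -[cv sv]; split=> //.
  move=> x y z xy yz Pyz zx.
  move/'forall_'forall_forallP: sv => /(_ (Ordinal (index_ordering_lt x uv))
    (Ordinal (index_ordering_lt y uv)) (Ordinal (index_ordering_lt z uv))).
  by rewrite !tnth_index_ordering /= xy yz Pyz zx.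
apply/'forall_'forall_forallP=> r s t; apply/implyP=> /and4P[rs st].
by apply: sv; rewrite !index_tnth_ordering.
Qed.

(** The enumeration of [G] is sorted by [f]; vertices of equal rank may come in either order, hence
    the weak inequality. *)
Lemma ordering_by_rank (f : G -> nat) :
  exists2 v, is_ordering v & forall x y, index x v < index y v -> f x <= f y.
Proof.
pose e := sort (fun x y => f x <= f y) (enum G).
have se : size e == #|G| by rewrite size_sort -cardE.
have me x : x \in e by rewrite mem_sort mem_enum.
exists (Tuple se); first by rewrite /is_ordering /= sort_uniq enum_uniq.
move=> x y /=.
apply: (sorted_ltn_index (leT := fun x y => f x <= f y)) => //.
  by move=> b a c; apply: leq_trans.
by apply: sort_sorted => a b; apply: leq_total.
Qed.

Lemma independent_same_class P x y : partition P [set: G] ->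
  [forall A in P, independent A] -> same_class P x y -> ~~ adj x y.
Proof.
move=> partP indP Pxy; have covP z : z \in cover P.
  by rewrite (cover_partition partP) inE.
have /forall_inP/(_ x) := forall_inP indP _ (pblock_mem (covP x)).
rewrite mem_pblock covP => /(_ isT)/forall_inP; apply.
by rewrite (eqP Pxy) mem_pblock.
Qed.

End Orderings.

Section HomProductPartition.
Variables (G1 G2 : sgraph) (P : {set {set G2}}).
Hypothesis partP : partition P [set: G2].

Local Notation G := (hom_product G1 G2).

Definition fiber_key (x : G) : G1 * {set G2} := (x.1, pblock P x.2).
Definition fiber_partition : {set {set G}} := preim_partition fiber_key [set: G].

Lemma fiber_partitionP : partition fiber_partition [set: G].
Proof. exact: preim_partitionP. Qed.

Lemma same_class_fiber x y :
  same_class fiber_partition x y = (x.1 == y.1) && same_class P x.2 y.2.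
Proof.
rewrite /same_class eq_pblock ?(partition_trivIset fiber_partitionP) //; last first.
  by rewrite (cover_partition fiber_partitionP) inE.
rewrite /fiber_partition /preim_partition pblock_equivalence_partition ?inE //.
by split=> // /eqP->.
Qed.

Lemma fiber_partition_independent : [forall A in fiber_partition, independent A].
Proof.
apply/forall_inP=> A AP; apply/forall_inP=> x xA; apply/forall_inP=> y yA.
have tP := partition_trivIset fiber_partitionP.
have : same_class fiber_partition x y by rewrite /same_class !(def_pblock tP AP).
by rewrite same_class_fiber => /andP[/eqP xy _]; rewrite /= /hom_adj xy eqxx.
Qed.

Lemma card_fiber_partition : #|fiber_partition| <= #|G1| * #|P|.
Proof.
rewrite -cardsT -cardsX.
(* [g] maps a key to its fiber; every class is the image of a key in [G1 * P]. *)
pose g (k : G1 * {set G2}) := [set y : G | k == fiber_key y].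
apply: leq_trans (leq_imset_card g _); apply/subset_leq_card/subsetP=> A.
case/imsetP=> x _ ->; apply/imsetP; exists (fiber_key x).
  by rewrite !inE pblock_mem // (cover_partition partP) inE.
by apply/setP=> y; rewrite !inE.
Qed.

Section Consistency.
Hypothesis indP : [forall A in P, independent A].
Variables (v2 : #|G2|.-tuple G2) (v : #|G|.-tuple G).
Hypotheses (uv2 : is_ordering v2) (uv : is_ordering v).
Hypothesis v_snd : forall x y : G,
  index x v < index y v -> index x.2 v2 <= index y.2 v2.

Lemma index_snd_inj (a b : G2) : index a v2 = index b v2 -> a = b.
Proof. exact: (index_inj a (mem_ordering a uv2) (mem_ordering b uv2)). Qed.

(** A tie in the second coordinate would make [x] and [y] equal, so within a class the weak
    inequality of [v_snd] is strict. *)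
Lemma index_snd_lt (x y : G) :
  index x v < index y v -> x.1 = y.1 -> index x.2 v2 < index y.2 v2.
Proof.
move=> xy e1; rewrite ltn_neqAle v_snd // andbT; apply/eqP=> /index_snd_inj e2.
by move: xy; rewrite (_ : x = y) ?ltnn //; case: x y e1 e2 => [??] [??] /= -> ->.
Qed.

Lemma fiber_consistent : consistent v2 P -> consistent v fiber_partition.
Proof.
move=> /(consistentP _ uv2) cv2; apply/consistentP=> // x y z xy yz.
rewrite same_class_fiber => /andP[/eqP e1 Pxy] /andP[zx1 zx2].
(* As [x.1 = y.1], the conditions on first coordinates pass from [x] to [y]; what remains is the
   case of an edge between [z.2] and [x.2]. *)
apply/andP; split; rewrite -e1 //.
case/orP: zx2 => [-> // | zx]; rewrite (cv2 x.2) ?orbT //.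
  exact: index_snd_lt.
(* If [y.2 = z.2], that edge would join [y.2] to [x.2] inside one class of [P]. *)
rewrite ltn_neqAle v_snd // andbT; apply: contraL zx => /eqP/index_snd_inj <-.
by rewrite adj_sym (independent_same_class partP indP).
Qed.

Lemma fiber_strongly_consistent :
  strongly_consistent v2 P -> strongly_consistent v fiber_partition.
Proof.
move=> /(strongly_consistentP _ uv2)[/fiber_consistent cv sv2].
apply/strongly_consistentP=> //; split=> // x y z xy yz.
rewrite same_class_fiber => /andP[/eqP e1 Pyz] /andP[zx1 zx2].
apply/andP; split; rewrite e1 //.
case/orP: zx2 => [-> // | zx]; rewrite (sv2 x.2 y.2 z.2) ?orbT //; last first.
  exact: index_snd_lt.
(* Here the possible tie is [x.2 = y.2], which would put the edge between [z.2] and [y.2], again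
   inside a class. *)
rewrite ltn_neqAle v_snd // andbT; apply: contraL zx => /eqP/index_snd_inj ->.
by rewrite adj_sym (independent_same_class partP indP).
Qed.

End Consistency.
End HomProductPartition.

(** Since [indthin_with] fixes the exact number of classes, the bound is stated through the actual
    number [m]. *)
Lemma hom_product_indthin_with (G1 G2 : sgraph) k : indthin_with G2 k ->
  exists2 m, indthin_with (hom_product G1 G2) m & m <= #|G1| * k.
Proof.
case/existsP=> P /and4P[partP /eqP<- indP /existsP[v2 /andP[uv2 cv2]]].
exists #|fiber_partition G1 P|; last exact: card_fiber_partition.
have [v uv vsnd] :=
  @ordering_by_rank (hom_product G1 G2) (fun x => index x.2 v2).
apply/existsP; exists (fiber_partition G1 P).
rewrite fiber_partitionP eqxx fiber_partition_independent /=.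
by apply/existsP; exists v; rewrite uv (fiber_consistent partP indP uv2 uv vsnd cv2).
Qed.

Lemma hom_product_indpthin_with (G1 G2 : sgraph) k : indpthin_with G2 k ->
  exists2 m, indpthin_with (hom_product G1 G2) m & m <= #|G1| * k.
Proof.
case/existsP=> P /and4P[partP /eqP<- indP /existsP[v2 /andP[uv2 cv2]]].
exists #|fiber_partition G1 P|; last exact: card_fiber_partition.
have [v uv vsnd] :=
  @ordering_by_rank (hom_product G1 G2) (fun x => index x.2 v2).
apply/existsP; exists (fiber_partition G1 P).
rewrite fiber_partitionP eqxx fiber_partition_independent /=.
by apply/existsP; exists v; rewrite uv (fiber_strongly_consistent partP indP uv2 uv vsnd cv2).
Qed.

Theorem theorem4p52 (G1 G2 : sgraph) :
  (thin (hom_product G1 G2) <= indthin (hom_product G1 G2) /\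
   indthin (hom_product G1 G2) <= #|G1| * indthin G2) /\
  (pthin (hom_product G1 G2) <= indpthin (hom_product G1 G2) /\
   indpthin (hom_product G1 G2) <= #|G1| * indpthin G2).
Proof.
rewrite /thin /indthin /pthin /indpthin; split; split.
- case: ex_minnP => m _; apply.
  by case: ex_minnP => k /indthin_thin.
(* An optimal partition of [G2] yields [m] classes on the product, and minimality bounds [indthin]
   by [m]. *)
- case: (ex_minnP (indthin_with_ex G2)) => k kP _.
  have [m mP] := hom_product_indthin_with G1 kP; apply: leq_trans.
  by case: ex_minnP => n _; apply.
- case: ex_minnP => m _; apply.
  by case: ex_minnP => k /indpthin_pthin.
- case: (ex_minnP (indpthin_with_ex G2)) => k kP _.
  have [m mP] := hom_product_indpthin_with G1 kP; apply: leq_trans.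
  by case: ex_minnP => n _; apply.
Qed.
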